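(* Let $(G,\tau)$ be a Hausdorff topological group that is A$_{\mathcal H}$-complete, where $\mathcal H$ is the class of all Hausdorff topological groups. If $Z(G)=\{e_G\}$, then $(G,\tau)$ is A-complete. Moreover, if $(G,\tau)$ is SIN, then $(G,\tau)$ is A-complete if and only if $Z(G)=\{e_G\}$.
   Context: Group topologies are not assumed Hausdorff unless stated. A continuous group isomorphism $f:(G,\tau)\to(H,\sigma)$ of topological groups is semitopological if there exist a topological group $(\widetilde G,\widetilde\tau)$ containing $G$ as a normal subgroup with $\widetilde\tau$ inducing $\tau$ on $G$, and an open continuous homomorphism $\widetilde f:(\widetilde G,\widetilde\tau)\to(H,\sigma)$ extending $f$. A topological group $(G,\tau)$ is A-complete if for every group topology $\sigma\le\tau$ on $G$ such that $id_G:(G,\tau)\to(G,\sigma)$ is semitopological, one has $\sigma=\tau$. A Hausdorff topological group $(G,\tau)$ is A$_{\mathcal H}$-complete if the same holds for every Hausdorff group topology $\sigma\le\tau$ on $G$. A topological group is SIN if it has a local base at $e_G$ consisting of neighborhoods invariant under conjugation. $Z(G)$ is the center of $G$. *)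

(* Defs.v *)
From HB Require Import structures.
From mathcomp Require Import all_boot.
From mathcomp Require Import boolp classical_sets functions topology.

Set Implicit Arguments.
Unset Strict Implicit.
Unset Printing Implicit Defensive.

Local Open Scope classical_set_scope.
Local Open Scope group_scope.

HB.mixin Record isTopologicalGroup G & Group G & Topological G := {
  mulg_continuous : continuous (fun p : G * G => p.1 * p.2);
  invg_continuous : continuous (fun x : G => x^-1)
}.

#[short(type="topologicalGroupType")]
HB.structure Definition TopologicalGroup :=
  {G of isTopologicalGroup G & Group G & Topological G}.

(* Several topologies on one group G have to coexist, so a topology on G is
   handled as a value [t], with the fields of the factory [isOpenTopological],
   and [with_topology t] is the copy of G that carries it. *)
Record topology_on (T : Type) := TopologyOn {
  topen : set_system T;
  topenT : topen setT;
  topenI : setI_closed topen;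
  topen_bigU : forall (I : Type) (f : I -> set T),
    (forall i, topen (f i)) -> topen (\bigcup_i f i)
}.

Definition with_topology (G : groupType) (t : topology_on G) : Type := G.

HB.instance Definition _ (G : groupType) (t : topology_on G) :=
  Group.copy (with_topology t) G.

HB.instance Definition _ (G : groupType) (t : topology_on G) :=
  isOpenTopological.Build (with_topology t)
    (topenT t) (@topenI _ t) (@topen_bigU _ t).

Record group_topology (G : groupType) := GroupTopology {
  gt_topology :> topology_on G;
  gt_mulg_continuous : continuous
    (fun p : with_topology gt_topology * with_topology gt_topology =>
       p.1 * p.2);
  gt_invg_continuous : continuous (fun x : with_topology gt_topology => x^-1)
}.

HB.instance Definition _ (G : groupType) (t : group_topology G) :=
  isTopologicalGroup.Build (with_topology t)
    (@gt_mulg_continuous _ t) (@gt_invg_continuous _ t).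

Definition continuous_isomorphism (G H : topologicalGroupType) (f : G -> H) :=
  [/\ {morph f : x y / x * y}, bijective f & continuous f].

(* The inclusion of G as a normal subgroup of the larger group is rendered by an
   injective homomorphism [i] with normal image; the larger group induces the
   topology of G when the open sets of G are the preimages of open sets. *)
Definition semitopological (G H : topologicalGroupType) (f : G -> H) : Prop :=
  continuous_isomorphism f /\
  exists (E : topologicalGroupType) (i : {multiplicative G -> E})
         (F : {multiplicative E -> H}),
    [/\ injective i,
        forall (x : G) (e : E), range i (i x ^ e),
        @open G = [set i @^-1` U | U in @open E],
        continuous F /\ (forall U : set E, open U -> open (F @` U))
      & forall x : G, F (i x) = f x].

Definition A_complete (G : groupType) (tau : group_topology G) : Prop :=
  forall sigma : group_topology G,
    topen sigma `<=` topen tau ->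
    semitopological (idfun : with_topology tau -> with_topology sigma) ->
    topen sigma = topen tau.

Definition AH_complete (G : groupType) (tau : group_topology G) : Prop :=
  forall sigma : group_topology G,
    hausdorff_space (with_topology sigma) ->
    topen sigma `<=` topen tau ->
    semitopological (idfun : with_topology tau -> with_topology sigma) ->
    topen sigma = topen tau.

Definition SIN (G : topologicalGroupType) : Prop :=
  forall U : set G, nbhs 1 U ->
    exists V : set G,
      [/\ nbhs 1 V, V `<=` U & forall x g : G, V x -> V (x ^ g)].

Definition center (G : groupType) : set G := [set z | forall x, commute z x].
Arguments center : clear implicits.

(* Main.v *)
Require Import Defs.
From HB Require Import structures.
From mathcomp Require Import all_boot.
From mathcomp Require Import boolp classical_sets functions topology.

(** If z lies in the closure of the identity for a semitopological coarsening
    sigma of tau, openness of the extension F produces elements of ker F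
    arbitrarily close to i z. They commute with i G, since ker F and i G are
    normal subgroups meeting trivially, so all commutators of z lie in the
    tau-closure of the identity and z is central. Hence sigma is Hausdorff when
    the center is trivial.

    Conversely, let sigma consist of the tau-open sets invariant under
    translation by the center Z. Multiplication G * Z -> (G, sigma), with Z
    indiscrete, is open and continuous and extends the identity of G, so
    A-completeness forces sigma = tau, and sigma separates no point of Z from
    the identity. *)

Set Implicit Arguments.
Unset Strict Implicit.
Unset Printing Implicit Defensive.

Local Open Scope classical_set_scope.
Local Open Scope group_scope.

(** * Limits and separation in topological groups *)

Section TopologicalGroupTheory.
Context {G : topologicalGroupType}.
Implicit Types (x y z : G) (A : set G).

Lemma cvgM (T : Type) (F : set_system T) {FF : Filter F} (f g : T -> G) x y :
  f @ F --> x -> g @ F --> y -> (fun t => f t * g t) @ F --> x * y.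
Proof.
move=> fx gy.
exact: (cvg_comp _ _ (cvg_pair fx gy) (@mulg_continuous G (x, y))).
Qed.

Lemma cvgV (T : Type) (F : set_system T) {FF : Filter F} (f : T -> G) x :
  f @ F --> x -> (fun t => (f t)^-1) @ F --> x^-1.
Proof. by move=> fx; apply: continuous_cvg => //; exact: invg_continuous. Qed.

Lemma commg_continuous x : continuous (fun y : G => [~ x, y]).
Proof.
move=> y; rewrite /commg /conjg.
by do ?[apply: cvgM|apply: cvgV]; (exact: cvg_cst || exact: cvg_id).
Qed.

Lemma mulgr_continuous x : continuous (fun y : G => y * x).
Proof. by move=> y; apply: cvgM; [exact: cvg_id|exact: cvg_cst]. Qed.

(** If neighborhoods of [x] and [y] always share a point [c], continuity of division puts
    [c * c^-1 = 1] in every neighborhood of [y * x^-1]. *)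
Lemma hausdorff_group :
  (forall x, (forall A, nbhs x A -> A 1) -> x = 1) -> hausdorff_space G.
Proof.
move=> sep1 x y xy; rewrite -[y]mulg1 -(mulVg x) mulgA.
suff -> : y * x^-1 = 1 by rewrite mul1g.
apply: sep1 => A yxA.
have : (fun p : G * G => p.2 * p.1^-1) @ (x, y) --> y * x^-1.
  by apply: cvgM; [exact: cvg_snd|apply: cvgV; exact: cvg_fst].
move=> /(_ _ yxA)[[B C] /= [xB yC] BCA].
have [c [Bc Cc]] := xy _ _ xB yC.
by have := BCA (c, c) (conj Bc Cc); rewrite /= mulgV.
Qed.

Lemma hausdorff_nbhs_eq1 : hausdorff_space G ->
  forall x, (forall A, nbhs x A -> A 1) -> x = 1.
Proof.
move=> hG x x1; apply: hG => A B /x1 A1 /nbhs_singleton B1.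
by exists 1.
Qed.

End TopologicalGroupTheory.

(* [{multiplicative G -> H}] only records compatibility with products. *)
Section MultiplicativeTheory.
Variables (G H : groupType) (f : {multiplicative G -> H}).

Lemma multiplicative1 : f 1 = 1.
Proof. by apply: (mulgI (f 1)); rewrite -gmulfM !mulg1. Qed.

Lemma multiplicativeV : {morph f : x / x^-1}.
Proof.
move=> x; apply: (mulgI (f x)).
by rewrite -gmulfM !mulgV multiplicative1.
Qed.

Lemma multiplicativeR : {morph f : x y / [~ x, y]}.
Proof. by move=> x y; rewrite /commg /conjg !gmulfM !multiplicativeV. Qed.

End MultiplicativeTheory.

Lemma semitopological_center (G H : topologicalGroupType) (f : G -> H) z :
  hausdorff_space G -> semitopological f ->
  (forall A, nbhs (f z) A -> A 1) -> center G z.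
Proof.
move=> hG [[_ /bij_inj f_inj _] [E [i [F [i_inj nG openG [_ openF] Ff]]]]] z1 x.
apply/commute_sym/commgP/eqP; apply: (hausdorff_nbhs_eq1 hG) => A.
rewrite nbhsE => -[B [oB Bxz] BA]; apply: BA.
move: oB; rewrite openG => -[U oU UB]; rewrite -UB /= multiplicative1.
(* [U] contains [i [~ x, z]], which is [[~ i x, i z]]. *)
have : nbhs (i z) [set e | U [~ i x, e]].
  apply: commg_continuous; apply: open_nbhs_nbhs; split=> //.
  by move: Bxz; rewrite -UB /= multiplicativeR.
rewrite nbhsE => -[W [oW Wz] WU].
have [|e We Fe] := z1 (F @` W).
  by apply: open_nbhs_nbhs; split; [exact: openF|exists (i z)].
(* By normality, [[~ i x, e] = (i x)^-1 * (i x) ^ e] is in the image of [i]. *)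
have [y _ iy] : range i [~ i x, e].
  have [y _ iy] := nG x e.
  by exists (x^-1 * y) => //; rewrite gmulfM multiplicativeV iy.
have y1 : y = 1.
  apply: f_inj; rewrite -!Ff iy multiplicativeR Fe !multiplicative1.
  by rewrite commg1.
by have := WU _ We; rewrite /= -iy y1 multiplicative1.
Qed.

(** * The center as a group in its own right *)

Section GroupOfCenter.
Variable G : groupType.

Lemma center1 : center G 1.
Proof. by move=> x; exact/commute_sym/commute1. Qed.

Lemma centerM x y : center G x -> center G y -> center G (x * y).
Proof. by move=> xZ yZ z; apply/commute_sym/commuteM; exact/commute_sym. Qed.

Lemma centerV x : center G x -> center G x^-1.
Proof. by move=> xZ z; exact/commute_sym/commuteV/commute_sym. Qed.

Definition center_pred : {pred G} := [pred z | z \in center G].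

Lemma center_group_closed : group_closed center_pred.
Proof.
split; first by rewrite inE; exact: center1.
by move=> x y; rewrite !inE => xZ yZ; exact/centerM/centerV.
Qed.

Definition center_group : Type := {z : G | center_pred z}.

HB.instance Definition _ := SubChoice.on center_group.
HB.instance Definition _ :=
  SubChoice_isSubGroup.Build G center_pred center_group center_group_closed.

Lemma center_val (z : center_group) : center G (val z).
Proof. by have := valP z; rewrite inE. Qed.

End GroupOfCenter.

(** The initial topology of the first projection is the product topology with the center
    indiscrete. *)
Definition indiscrete_central_product (G : topologicalGroupType) : Type :=
  initial_topology (fst : G * center_group G -> G).

Section IndiscreteCentralProduct.
Variable G : topologicalGroupType.
Local Notation E := (indiscrete_central_product G).

HB.instance Definition _ :=
  Topological.copy E (initial_topology (fst : G * center_group G -> G)).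
HB.instance Definition _ := Group.copy E (G * center_group G)%type.

Let fst_continuous : continuous (fst : E -> G).
Proof. exact: initial_continuous. Qed.

Let cvg_fst_initial (T : Type) (F : set_system T) (h : T -> E) (e : E) :
  Filter F -> (fun t => (h t).1) @ F --> e.1 -> h @ F --> e.
Proof.
move=> FF Fe A [B [[C oC <-] Ce CA]].
apply: (@filterS T F FF [set t | C (h t).1]); first by move=> t; exact: CA.
by apply: Fe; exact: open_nbhs_nbhs.
Qed.

Let mulE_continuous : continuous (fun p : E * E => p.1 * p.2).
Proof.
move=> [x y]; apply: cvg_fst_initial.
apply: (@cvgM G (E * E)%type (nbhs (x, y)) _ (fst \o fst) (fst \o snd)).
- apply: cvg_comp; [exact: cvg_fst|exact: fst_continuous].
- apply: cvg_comp; [exact: cvg_snd|exact: fst_continuous].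
Qed.

Let invE_continuous : continuous (fun x : E => x^-1).
Proof.
move=> x; apply: (cvg_fst_initial (F := nbhs x)).
exact: (cvgV (F := nbhs x) (@fst_continuous x)).
Qed.

HB.instance Definition _ :=
  isTopologicalGroup.Build E mulE_continuous invE_continuous.

End IndiscreteCentralProduct.

(** * The coarsening of [tau] by the center *)

Section CenterCoarsening.
Context {G : groupType} (tau : group_topology G).
Let Gt := with_topology tau.

(** These are the preimages of the open sets of the quotient of G by its center. *)
Definition center_open : set_system G :=
  [set A | topen tau A /\ forall x z, center G z -> A x -> A (x * z)].

Let center_openT : center_open setT.
Proof. by split=> //; exact: topenT. Qed.

Let center_openI : setI_closed center_open.
Proof.
move=> A B [oA cA] [oB cB]; split; first exact: topenI.
by move=> x z zZ [Ax Bx]; split; [exact: cA|exact: cB].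
Qed.

Let center_open_bigU (I : Type) (f : I -> set G) :
  (forall i, center_open (f i)) -> center_open (\bigcup_i f i).
Proof.
move=> of_; split; first by apply: topen_bigU => i; have [] := of_ i.
move=> x z zZ [i _ fx]; exists i => //.
by have [_] := of_ i; exact.
Qed.

Definition center_topology : topology_on G :=
  TopologyOn center_openT center_openI center_open_bigU.

Let Gs := with_topology center_topology.

(** This is the product set of [A] and the center, since the center is closed under inverses; in
    this form it is a union of preimages of [A] under translations. *)
Definition center_saturation (A : set G) : set G :=
  [set x | exists2 z, center G z & A (x * z)].

Lemma center_saturation_open (A : set G) :
  topen tau A -> center_open (center_saturation A).
Proof.
move=> oA; split.
  have -> : center_saturation A =
      \bigcup_(z : center_group G) ((fun x : G => x * val z) @^-1` A).
    apply/seteqP; split=> x.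
      move=> [z zZ Axz]; have zP : center_pred z by rewrite inE.
      by exists (Sub z zP) => //=; rewrite SubK.
    by move=> [z _ Axz]; exists (val z) => //; exact: center_val.
  apply: topen_bigU => z.
  by have /continuousP := @mulgr_continuous Gt (val z); apply.
move=> x z zZ [w wZ Axw]; exists (z^-1 * w); last by rewrite mulgA mulgK.
exact: centerM (centerV zZ) wZ.
Qed.

Lemma sub_center_saturation (A : set G) : A `<=` center_saturation A.
Proof. by move=> x Ax; exists 1; [exact: center1|rewrite mulg1]. Qed.

Lemma nbhs_center_saturation (x : G) (A : set G) :
  nbhs (x : Gt) A -> nbhs (x : Gs) (center_saturation A).
Proof.
move=> [B [oB Bx BA]]; exists (center_saturation B).
split; [exact: center_saturation_open|exact: sub_center_saturation|].
by move=> y [z zZ Byz]; exists z => //; exact: BA.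
Qed.

Let center_mulg_continuous : continuous (fun p : Gs * Gs => p.1 * p.2).
Proof.
move=> [x y] A [B [[oB cB] Bxy BA]].
have : nbhs ((x : Gt) * (y : Gt)) B by exact: open_nbhs_nbhs.
move=> /(@mulg_continuous Gt (x, y))[[C D] /= [xC yD] CDB].
exists (center_saturation C, center_saturation D).
  by split; exact: nbhs_center_saturation.
move=> [a b] [[z zZ Caz] [w wZ Dbw]]; apply: BA => /=.
(* The central factors of [(a * z) * (b * w)] gather into [w * z], which invariance of [B] then
   cancels. *)
have := CDB (a * z, b * w) (conj Caz Dbw) => /= Babzw.
have {Babzw} : B (a * b * (w * z)).
  have -> : a * b * (w * z) = (a * z) * (b * w); last by [].
  by rewrite -[RHS]mulgA zZ !mulgA.
by move=> /(cB _ _ (centerV (centerM wZ zZ))); rewrite mulgK.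
Qed.

Let center_invg_continuous : continuous (fun x : Gs => x^-1).
Proof.
move=> x A [B [[oB cB] Bx BA]].
have : nbhs ((x : Gt)^-1) B by exact: open_nbhs_nbhs.
move=> /(@invg_continuous Gt x) /nbhs_center_saturation; apply: filterS.
move=> a [z zZ /= Baz]; apply: BA.
by have := cB _ _ zZ Baz; rewrite invgM -mulgA -zZ mulKg.
Qed.

Definition center_group_topology : group_topology G :=
  GroupTopology center_mulg_continuous center_invg_continuous.

Lemma center_topology_coarser : topen center_group_topology `<=` topen tau.
Proof. by move=> A []. Qed.

(** * Multiplication by the center as an open extension of the identity *)

Let Gc := with_topology center_group_topology.
Let E := indiscrete_central_product Gt.

Let incl (x : Gt) : E := (x, 1).
Let inclM : {morph incl : x y / x * y}.
Proof. by move=> x y; congr (_, _); rewrite mulg1. Qed.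
HB.instance Definition _ := isMultiplicative.Build Gt E incl inclM.

Let prod_center (e : E) : Gc := e.1 * val e.2.
Let prod_centerM : {morph prod_center : x y / x * y}.
Proof.
move=> [x z] [y w]; rewrite /prod_center /=.
transitivity (x * y * (val z * val w)).
  by congr (_ * _); exact: (valM z w).
by rewrite -!mulgA; congr (_ * _); rewrite !mulgA (center_val z y).
Qed.
HB.instance Definition _ :=
  isMultiplicative.Build E Gc prod_center prod_centerM.

Lemma center_topology_semitopological : semitopological (idfun : Gt -> Gc).
Proof.
split.
  split; [by []|by exists idfun|].
  by apply/continuousP => A /center_topology_coarser.
exists E, incl, prod_center; split.
- by move=> x y [].
(* Conjugating [(x, 1)] by [(y, z)] gives [(x ^ y, 1)]. *)
- move=> x [y z]; exists (x ^ y) => //.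
  by congr (_, _); exact/esym/conj1g.
- apply/seteqP; split.
    by move=> A oA; exists (fst @^-1` A) => //; exists A.
  by move=> _ [_ [A oA <-] <-].
- split.
    apply/continuousP => A [oA cA]; exists A => //.
    (* As [A] is invariant under the center, its preimages under [fst] and [prod_center]
       coincide. *)
    apply/seteqP; split=> -[x z] /=; rewrite /prod_center /=.
      by apply: cA; exact: center_val.
    by move=> /(cA _ _ (centerV (center_val z))); rewrite mulgK.
  move=> _ [A oA <-].
  (* Every open set of [E] is a full cylinder over some open [A], and multiplication sends it onto
     the saturation of [A]. *)
  have -> : prod_center @` (fst @^-1` A) = center_saturation A.
    apply/seteqP; split=> x.
      move=> [[a z] Aa <-]; exists (val z)^-1.
        exact: centerV (center_val z).
      by rewrite /prod_center /= mulgK.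
    move=> [z zZ Axz]; have zP : center_pred z^-1.
      by rewrite inE; exact: centerV.
    by exists (x * z, Sub z^-1 zP) => //; rewrite /prod_center /= mulgK.
  exact: center_saturation_open.
- by move=> x; exact: mulg1.
Qed.

End CenterCoarsening.

(** * The two implications between completeness and trivial center *)

Lemma A_complete_center1 (G : groupType) (tau : group_topology G) :
  hausdorff_space (with_topology tau) -> A_complete tau -> center G = [set 1].
Proof.
move=> htau complete; apply/seteqP; split=> [z zZ|_ ->]; last first.
  exact: center1.
apply: (hausdorff_nbhs_eq1 htau) => A [B [oB Bz BA]]; apply: BA.
have := complete _ (@center_topology_coarser _ tau)
  (@center_topology_semitopological _ tau).
(* Equality of the topologies makes the [tau]-open set [B] invariant under the center, so [B]
   contains [z * z^-1 = 1]. *)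
move=> topE; move: oB; rewrite /= -topE => -[_ cB].
by rewrite -(mulgV z); apply: cB => //; exact: centerV.
Qed.

Lemma center1_A_complete (G : groupType) (tau : group_topology G) :
  hausdorff_space (with_topology tau) -> AH_complete tau ->
  center G = [set 1] -> A_complete tau.
Proof.
move=> htau complete Z1 sigma sub semi; apply: complete => //.
apply: hausdorff_group => z z1.
have : center G z by exact: semitopological_center htau semi z1.
by rewrite Z1.
Qed.

Theorem mainTheorem5 (G : groupType) (tau : group_topology G)
    (hausdorff_tau : hausdorff_space (with_topology tau))
    (AH_complete_tau : AH_complete tau) :
  (center G = [set 1%g]%classic -> A_complete tau) /\
  (SIN (with_topology tau) -> (A_complete tau <-> center G = [set 1%g]%classic)).
Proof.
split=> [|_]; first exact: center1_A_complete.
by split; [exact: A_complete_center1|exact: center1_A_complete].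
Qed.
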